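(* Let $\omega_0>0$ and $u^-\in\mathcal{L}^2([0,2\pi];\mathbb{R})$. The projection of $u^-$ onto $\mathcal{A}_{\omega_0,1}$, i.e. the solution of the problem of minimizing $\frac12\|u-u^-\|_{\mathcal{L}^2}^2$ subject to $u\in\mathcal{A}_{\omega_0,1}$, is given by $$P_{\mathcal{A}_{\omega_0,1}}(u^-)(t)=u^-(t)+\frac{e^{\omega_0(t-2\pi)}}{y_{11}y_{22}-y_{12}y_{21}}\left(-\big((y_{22}+y_{12}\omega_0)t+y_{12}\big)\left(\hat x_1-\frac{s_f}{e^{-2\pi\omega_0}}\right)+\big((y_{21}+y_{11}\omega_0)t+y_{11}\big)\left(\hat x_2-\frac{v_f}{e^{-2\pi\omega_0}}\right)\right),$$ where $$y_{11}=\frac{e^{-2\pi\omega_0}(2\pi\omega_0-e^{4\pi\omega_0}+2\pi\omega_0e^{4\pi\omega_0}+1)}{4\omega_0^3},\qquad y_{12}=\frac{\pi\sinh(2\pi\omega_0)}{\omega_0},$$ $$y_{21}=-\frac{\pi\sinh(2\pi\omega_0)}{\omega_0},\qquad y_{22}=-\frac{e^{-2\pi\omega_0}(2\pi\omega_0+e^{4\pi\omega_0}+2\pi\omega_0e^{4\pi\omega_0}-1)}{4\omega_0},$$ and $(\hat x_1,\hat x_2):=e^{2\pi\omega_0}\,(x_1(2\pi),x_2(2\pi))$, with $(x_1,x_2)$ the solution of $\dot x_1=x_2$, $\dot x_2=-\omega_0^2x_1-2\omega_0x_2+u^-$, $x_1(0)=s_0$, $x_2(0)=v_0$.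
   Context: $\mathcal{L}^2([0,2\pi];\mathbb{R})$ is the Hilbert space of square-integrable functions (identified when equal almost everywhere) and $\mathcal{W}^{1,2}([0,2\pi];\mathbb{R}^2)$ the space of absolutely continuous functions in $\mathcal{L}^2$ with derivative in $\mathcal{L}^2$. For given $s_0,s_f,v_0,v_f\in\mathbb{R}$ (with $t_f=2\pi$ and damping ratio $\zeta=1$, the critically damped harmonic oscillator), $$\mathcal{A}_{\omega_0,1}:=\{u\in\mathcal{L}^2([0,2\pi];\mathbb{R}):\exists x\in\mathcal{W}^{1,2}([0,2\pi];\mathbb{R}^2)\text{ with }\dot x_1=x_2,\ \dot x_2=-\omega_0^2x_1-2\omega_0x_2+u,\ x_1(0)=s_0,\ x_1(2\pi)=s_f,\ x_2(0)=v_0,\ x_2(2\pi)=v_f\}.$$ *)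

(* Defs.v *)
From mathcomp Require Import all_boot all_order all_algebra.
From mathcomp Require Import all_classical all_reals all_analysis.

Set Implicit Arguments.
Unset Strict Implicit.
Unset Printing Implicit Defensive.

Import Order.TTheory GRing.Theory Num.Theory.
Import numFieldNormedType.Exports.

Local Open Scope classical_set_scope.
Local Open Scope ring_scope.

Section Spaces.
Context {R : realType}.

(* Functions on [0, 2 pi] are represented by functions on R considered up to
   null sets of the Lebesgue measure concentrated on [0, 2 pi]; "almost
   everywhere" for this measure never constrains points outside [0, 2 pi]. *)
Definition mu02pi : {measure set (measurableTypeR R) -> \bar R} :=
  mrestr (@lebesgue_measure R) (measurable_itv `[0, 2 * pi]).

Definition L2 := LspaceType2 mu02pi.

Definition L2norm (f : R -> R) : R := fine ('N[mu02pi]_2%:E [EFin \o f])%E.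

(* Equality in L2 is Leibniz equality of a.e. classes, so uniqueness of the
   minimizer is q = p; coercing to a function picks a representative. *)
Definition is_projection (A : set L2) (u p : L2) : Prop :=
  let J (v : L2) : R := 2^-1 * L2norm (v \- u) ^+ 2 in
  let minimizer (q : L2) := A q /\ forall v, A v -> J q <= J v in
  minimizer p /\ forall q, minimizer q -> q = p.

(* Degenerate intervals l i = r i are allowed; they contribute 0 to both sums. *)
Definition abs_cont (a b : R) (f : R -> R) : Prop :=
  forall e : R, 0 < e -> exists2 d : R, 0 < d &
    forall (n : nat) (l r : 'I_n -> R),
      (forall i, [/\ a <= l i, l i <= r i & r i <= b]) ->
      trivIset [set: 'I_n] (fun i => `]l i, r i[%classic) ->
      \sum_(i < n) (r i - l i) < d ->
      \sum_(i < n) `|f (r i) - f (l i)| < e.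

Definition has_ae_derivative (f g : R -> R) : Prop :=
  {ae mu02pi, forall t : R, is_derive t 1 f (g t)}.

(* Membership in L2 is asserted for the class of f, resp. of its a.e. derivative:
   the function f itself is unconstrained outside [0, 2 pi]. *)
Definition W12 (f : R -> R) : Prop :=
  [/\ abs_cont 0 (2 * pi) f,
      exists g : L2, {ae mu02pi, forall t, f t = g t}
    & exists g : L2, has_ae_derivative f g].

(* The R^2-valued state is given by its two components. *)
Definition oscillator_state (omega0 : R) (u : L2) (x1 x2 : R -> R) : Prop :=
  [/\ W12 x1, W12 x2,
      has_ae_derivative x1 x2
    & has_ae_derivative x2
        (fun t => - omega0 ^+ 2 * x1 t - 2 * omega0 * x2 t + u t)].

Definition admissible_controls (omega0 s0 sf v0 vf : R) : set L2 :=
  [set u | exists x1 x2 : R -> R,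
     [/\ oscillator_state omega0 u x1 x2,
         x1 0 = s0, x1 (2 * pi) = sf, x2 0 = v0 & x2 (2 * pi) = vf]].

Definition sinh (x : R) : R := (expR x - expR (- x)) / 2.

Definition y11 (w : R) : R :=
  expR (- 2 * pi * w)
  * (2 * pi * w - expR (4 * pi * w) + 2 * pi * w * expR (4 * pi * w) + 1)
  / (4 * w ^+ 3).

Definition y12 (w : R) : R := pi * sinh (2 * pi * w) / w.

Definition y21 (w : R) : R := - (pi * sinh (2 * pi * w) / w).

Definition y22 (w : R) : R :=
  - (expR (- 2 * pi * w)
     * (2 * pi * w + expR (4 * pi * w) + 2 * pi * w * expR (4 * pi * w) - 1)
     / (4 * w)).

Definition projection_formula (w sf vf xh1 xh2 : R) (u : R -> R) (t : R) : R :=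
  u t + expR (w * (t - 2 * pi)) / (y11 w * y22 w - y12 w * y21 w)
    * (- ((y22 w + y12 w * w) * t + y12 w)
         * (xh1 - sf / expR (- 2 * pi * w))
       + ((y21 w + y11 w * w) * t + y11 w)
         * (xh2 - vf / expR (- 2 * pi * w))).

End Spaces.

Arguments L2 R : clear implicits.

(* Main.v *)
Require Import Defs.
From HB Require Import structures.
From mathcomp Require Import all_boot all_order all_algebra.
From mathcomp Require Import all_classical all_reals all_analysis.
From mathcomp Require Import measurable_realfun ring lra.
Import Order.TTheory GRing.Theory Num.Theory.
Import numFieldNormedType.Exports.
Local Open Scope classical_set_scope.
Local Open Scope ring_scope.

Set Implicit Arguments.
Unset Strict Implicit.
Unset Printing Implicit Defensive.

(** Put w = omega0. For a state (x1, x2) driven by the control u, the function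
    z1 = e^(w t) x1 satisfies z1'' = e^(w t) u. Hence, for given initial values,
    the final values are prescribed exactly when the inner products of u with
    e^(w t) and t e^(w t) are prescribed: the admissible controls form an affine
    subspace of codimension two, and the projection of u is the admissible
    control p such that p - u is a combination e^(w t) (al + be t) of these two
    functions.

    Three facts make this precise. First, a difference of admissible controls is
    orthogonal to e^(w t) (al + be t) ([oscillator_state_orthogonal]). Secondly,
    an admissible p for which p - u is orthogonal to all v - p, with v
    admissible, is the unique minimizer, by Pythagoras
    ([is_projection_orthogonal]). Thirdly, the response from rest to the control
    e^(w t) (al + be t) has a closed form, and the coefficients of the formula
    make it cancel the deviation of the final state ([response_final]). The
    denominator of the formula is (sinh(a)^2 - a^2) / (4 w^4) with a = 2 pi w,
    and it is positive because sinh a > a ([gram_det_gt0]). As the response is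
    explicit, admissibility of p is checked by differentiation alone.

    States are only absolutely continuous, so the first fact relies on the
    fundamental theorem of calculus for absolutely continuous functions
    ([abs_cont_FTC2]). It reduces, through the almost everywhere
    differentiability of indefinite integrals, to the constancy of an absolutely
    continuous function whose derivative vanishes almost everywhere
    ([abs_cont_derive0]). The existence of a state with given initial values
    ([ex_oscillator_state]) follows by integrating z1'' = e^(w t) u twice. *)

(** * Integration against a restricted measure *)

Section restricted_measure.
Context d (T : measurableType d) (R : realType).
Variables (mu : {measure set T -> \bar R}) (D : set T) (mD : measurable D).
Local Open Scope ereal_scope.

Lemma ge0_integral_mrestr (f : T -> \bar R) :
  measurable_fun [set: T] f -> (forall x, 0 <= f x) ->
  \int[mrestr mu mD]_x f x = \int[mu]_(x in D) f x.
Proof.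
move=> mf f0.
have mDc : measurable (~` D) by exact: measurableC.
rewrite -[X in integral _ X _](setUv D) ge0_integral_setU//=; last first.
- exact/disj_setPCl.
- by rewrite setUv.
(* The restricted measure agrees with [mu] inside [D], vanishes outside. *)
rewrite (eq_measure_integral mu); last first.
  by move=> A mA AD /=; rewrite /mrestr setIidl.
rewrite [X in _ + X](eq_measure_integral mzero) ?integral_measure_zero ?adde0//.
by move=> A mA /disj_setPLR/disj_set2P AD /=; rewrite /mrestr AD measure0.
Qed.

Lemma integral_mrestr (f : T -> \bar R) : measurable_fun [set: T] f ->
  \int[mrestr mu mD]_x f x = \int[mu]_(x in D) f x.
Proof.
move=> mf; rewrite [LHS]integralE [RHS]integralE.
rewrite !ge0_integral_mrestr//; first exact: measurable_funeneg.
exact: measurable_funepos.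
Qed.

Lemma integrable_mrestr (f : T -> \bar R) : measurable_fun [set: T] f ->
  (mrestr mu mD).-integrable setT f <-> mu.-integrable D f.
Proof.
move=> mf; split=> /integrableP[_ foo]; apply/integrableP; split=> //.
- exact: measurable_funTS.
- by rewrite -ge0_integral_mrestr//; exact: measurableT_comp.
- by rewrite ge0_integral_mrestr//; exact: measurableT_comp.
Qed.

Lemma ae_mrestr (P : T -> Prop) :
  {ae mrestr mu mD, forall x, P x} <-> {ae mu, forall x, D x -> P x}.
Proof.
split=> [[N [mN N0 NP]]|[N [mN N0 NP]]].
- exists (N `&` D); split=> //; first exact: measurableI.
  by move=> x /= /not_implyP[Dx Px]; split=> //; apply: NP.
- exists (N `|` ~` D); split=> //.
  + by apply: measurableU => //; exact: measurableC.
  + rewrite /mrestr/= setIUl setICl setU0.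
    by apply: (@subset_measure0 _ _ _ mu _ N) => //; exact: measurableI.
  + move=> x /= Px; have [Dx|] := pselect (D x); last by right.
    by left; apply: NP => /= /(_ Dx).
Qed.

End restricted_measure.

(** * Absolutely continuous functions *)

Section absolute_continuity.
Context {R : realType}.
Variables a b : R.
Implicit Types f g : R -> R.

Lemma eq_abs_cont f g : (forall t, a <= t <= b -> f t = g t) ->
  abs_cont a b f -> abs_cont a b g.
Proof.
move=> fg acf e e0; have [d d0 fd] := acf e e0; exists d => // n l r lr tI sd.
rewrite (eq_bigr (fun i => `|f (r i) - f (l i)|)); first exact: fd.
by move=> i _; have [al le_lr rb] := lr i; rewrite !fg//; lra.
Qed.

Lemma abs_contD f g : abs_cont a b f -> abs_cont a b g ->
  abs_cont a b (fun t => f t + g t).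
Proof.
move=> acf acg e e0.
have [d d0 fd] := acf (e / 2) ltac:(lra).
have [d' d'0 gd] := acg (e / 2) ltac:(lra).
exists (Num.min d d'); first by rewrite lt_min d0.
move=> n l r lr tI; rewrite lt_min => /andP[sd sd'].
have := fd n l r lr tI sd; have := gd n l r lr tI sd' => gs fs.
apply: (@le_lt_trans _ _
    (\sum_(i < n) (`|f (r i) - f (l i)| + `|g (r i) - g (l i)|))).
  apply: ler_sum => i _.
  have -> : f (r i) + g (r i) - (f (l i) + g (l i)) =
      (f (r i) - f (l i)) + (g (r i) - g (l i)) by ring.
  exact: ler_normD.
by rewrite big_split/=; lra.
Qed.

Lemma lipschitz_abs_cont f (K : R) : 0 < K ->
  (forall s t, a <= s -> s <= t -> t <= b -> `|f t - f s| <= K * (t - s)) ->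
  abs_cont a b f.
Proof.
move=> K0 fK e e0; exists (e / K); first exact: divr_gt0.
move=> n l r lr _ sd.
apply: (@le_lt_trans _ _ (\sum_(i < n) K * (r i - l i))).
  by apply: ler_sum => i _; have [al le_lr rb] := lr i; exact: fK.
by rewrite -mulr_sumr mulrC -ltr_pdivlMr.
Qed.

Lemma abs_cont_cst (c : R) : abs_cont a b (fun=> c).
Proof.
apply: (@lipschitz_abs_cont _ 1) => // s t _ st _.
by rewrite subrr normr0 mul1r subr_ge0.
Qed.

Lemma abs_cont_id : abs_cont a b id.
Proof.
apply: (@lipschitz_abs_cont _ 1) => // s t _ st _.
by rewrite mul1r ger0_norm// subr_ge0.
Qed.

Lemma abs_cont_itv1 f : abs_cont a b f ->
  forall e : R, 0 < e -> exists2 d : R, 0 < d & forall s t,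
    a <= s -> s <= t -> t <= b -> t - s < d -> `|f t - f s| < e.
Proof.
move=> acf e e0; have [d d0 fd] := acf e e0; exists d => // s t sa st tb tsd.
have := fd 1%N (fun=> s) (fun=> t); rewrite !big_ord1; apply=> //.
by move=> i j _ _ _; rewrite (ord1 i) (ord1 j).
Qed.

Lemma abs_cont_continuous f : a <= b -> abs_cont a b f ->
  {within `[a, b], continuous f}.
Proof.
move=> ab acf.
(* Composing [f] with the retraction [p] of the line onto [a, b] makes it
   uniformly continuous everywhere, with the same values on [a, b]. *)
pose p (t : R) := Num.max a (Num.min t b).
have pE t : a <= t <= b -> p t = t.
  by move=> /andP[aT tb]; rewrite /p (min_idPl tb) (max_idPr aT).
apply: (@subspace_eq_continuous _ _ _ (f \o p)).
  by move=> t /set_mem/=; rewrite in_itv/= => tab; rewrite /comp pE.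
apply: continuous_subspaceT => t.
have pab u : a <= p u <= b by rewrite /p le_max lexx ge_max ab ge_min lexx orbT.
apply/cvgrPdist_lt => e e0; have [d d0 fd] := abs_cont_itv1 acf e0.
have fpd s s' : s <= s' -> s' - s < d -> `|f (p s') - f (p s)| < e.
  move=> ss' s'sd; have /andP[aps _] := pab s; have /andP[_ ps'b] := pab s'.
  apply: fd => //.
    rewrite /p ge_max le_max lexx/= le_max; apply/orP; right.
    by rewrite le_min !ge_min ss' lexx/= orbT.
  apply: le_lt_trans s'sd.
  rewrite lerBlDr {1}/p ge_max; apply/andP; split; first lra.
  have [sb|bs] := leP s b.
    have : s <= p s by rewrite /p (min_idPl sb) le_max lexx orbT.
    have : Num.min s' b <= s' by rewrite ge_min lexx.
    lra.
  have : b <= p s by rewrite /p (min_idPr (ltW bs)) le_max lexx orbT.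
  have : Num.min s' b <= b by rewrite ge_min lexx orbT.
  lra.
near=> s.
have : `|t - s| < d by near: s; exact: cvgr_dist_lt.
have [st|/ltW ts] := leP s t.
  by rewrite ger0_norm ?subr_ge0// => /fpd; exact.
by rewrite distrC ger0_norm ?subr_ge0// => /fpd; rewrite distrC; exact.
Unshelve. all: by end_near. Qed.

Lemma abs_cont_bounded f : a <= b -> abs_cont a b f ->
  exists2 M : R, 0 < M & forall t, a <= t <= b -> `|f t| <= M.
Proof.
move=> ab /(abs_cont_continuous ab) cf.
have cnf : {within `[a, b], continuous (fun t => `|f t|)}.
  by move=> t; apply: continuous_comp; [exact: cf|exact: norm_continuous].
have [c _ fc] := EVT_max ab cnf.
exists (`|f c| + 1) => [|t tab]; first by rewrite ltr_wpDl.
by rewrite (le_trans (fc t _)) ?in_itv//= lerDl.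
Qed.

Lemma abs_contM f g : a <= b -> abs_cont a b f -> abs_cont a b g ->
  abs_cont a b (fun t => f t * g t).
Proof.
move=> ab acf acg e e0.
have [M M0 fM] := abs_cont_bounded ab acf.
have [N N0 gN] := abs_cont_bounded ab acg.
have [|d d0 fd] := acf (e / (2 * N)); first by rewrite divr_gt0// mulr_gt0.
have [|d' d'0 gd] := acg (e / (2 * M)); first by rewrite divr_gt0// mulr_gt0.
exists (Num.min d d'); first by rewrite lt_min d0.
move=> n l r lr tI; rewrite lt_min => /andP[sd sd'].
have := fd n l r lr tI sd; have := gd n l r lr tI sd'.
rewrite !ltr_pdivlMr ?mulr_gt0// => gs fs.
apply: (@le_lt_trans _ _
    (\sum_(i < n) (N * `|f (r i) - f (l i)| + M * `|g (r i) - g (l i)|))).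
  apply: ler_sum => i _; have [al le_lr rb] := lr i.
  have -> : f (r i) * g (r i) - f (l i) * g (l i) =
      g (l i) * (f (r i) - f (l i)) + f (r i) * (g (r i) - g (l i)) by ring.
  rewrite (le_trans (ler_normD _ _))// !normrM lerD// ler_wpM2r//.
    by apply: gN; lra.
  by apply: fM; lra.
rewrite big_split/= -!mulr_sumr; lra.
Qed.

Lemma abs_contZ f (k : R) : a <= b -> abs_cont a b f ->
  abs_cont a b (fun t => k * f t).
Proof. by move=> ab; apply: abs_contM => //; exact: abs_cont_cst. Qed.

Lemma abs_contB f g : a <= b -> abs_cont a b f -> abs_cont a b g ->
  abs_cont a b (fun t => f t - g t).
Proof.
move=> ab acf acg; apply: eq_abs_cont (abs_contD acf (abs_contZ (-1) ab acg)).
by move=> t _; ring.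
Qed.

Lemma derive_abs_cont f f' : a <= b -> (forall t : R, is_derive t 1 f (f' t)) ->
  continuous f' -> abs_cont a b f.
Proof.
move=> ab df cf'.
have cf : continuous f.
  move=> t; apply/differentiable_continuous/derivable1_diffP.
  by have [] := df t.
have cnf : {within `[a, b], continuous (fun t => `|f' t|)}.
  apply: continuous_subspaceT => t.
  by apply: continuous_comp; [exact: cf'|exact: norm_continuous].
have [c _ fc] := EVT_max ab cnf.
apply: (@lipschitz_abs_cont _ (`|f' c| + 1)) => [|s t sa st tb].
  by rewrite ltr_wpDl.
have [|x xst ->] := @MVT_segment _ f f' s t st (fun x _ => df x).
  exact: continuous_subspaceT.
rewrite normrM (ger0_norm (_ : 0 <= t - s)) ?subr_ge0// ler_wpM2r ?subr_ge0//.
rewrite (le_trans (fc x _)) ?lerDl//.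
by move: xst; rewrite !in_itv/=; lra.
Qed.

End absolute_continuity.

(** * Zero derivative almost everywhere implies constancy *)

(** A property passes from [a] to [b] as soon as every point [c] has a
    neighbourhood across which it propagates from the left of [c] to its
    right. *)
Lemma real_induction (R : realType) (a b : R) (P : R -> Prop) : a <= b ->
  P a ->
  (forall c, a <= c <= b -> exists2 rho : R, 0 < rho &
    forall s t, a <= s <= c -> c <= t <= b -> c - rho < s -> t < c + rho ->
      P s -> P t) ->
  P b.
Proof.
move=> ab Pa step; pose S := [set t | a <= t <= b /\ P t].
have Sa : S a by rewrite /S/= lexx.
have ubS : has_ubound S by exists b => t /= [/andP[]].
have supS : has_sup S by split=> //; exists a.
have leS t : S t -> t <= sup S by move=> St; exact: ub_le_sup.
have cb : sup S <= b by apply: ge_sup; [exists a|move=> t /= [/andP[]]].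
have cab : a <= sup S <= b by rewrite leS.
have [rho rho0 stepc] := step _ cab.
have [s Ss cs] := sup_adherent rho0 supS.
have [/andP[sa sb] Ps] := Ss.
have asc : a <= s <= sup S by rewrite sa leS.
have cc : sup S < sup S + rho by rewrite ltrDl.
have [cltb|] := ltP (sup S) b; last first.
  move=> bc; have <- : sup S = b by apply/eqP; rewrite eq_le cb.
  by apply: stepc Ps => //; rewrite lexx.
pose t := Num.min b (sup S + rho / 2).
have ct : sup S < t by rewrite lt_min cltb ltrDl divr_gt0.
have tb : t <= b by rewrite ge_min lexx.
have /leS : S t.
  split; first by rewrite tb andbT (le_trans _ (ltW ct))//; case/andP: cab.
  apply: stepc Ps => //; first by rewrite ltW.
  apply: (@le_lt_trans _ _ (sup S + rho / 2)); last by rewrite ltrD2l; lra.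
  by rewrite ge_min lexx orbT.
by rewrite leNgt ct.
Qed.

Section constancy.
Context {R : realType}.
Notation mu := (@lebesgue_measure R).

Lemma lebesgue_measure_bigsetU_itv (n : nat) (l r : 'I_n -> R) :
  (forall i, l i <= r i) ->
  trivIset [set: 'I_n] (fun i => `]l i, r i[%classic) ->
  mu (\big[setU/set0]_(i < n) (`]l i, r i[%classic : set R)) =
  (\sum_(i < n) (r i - l i))%:E.
Proof.
move=> lr tI; pose F i : set R := `]l i, r i[%classic.
have mF i : measurable (F i) by exact: measurable_itv.
rewrite -/F measure_semi_additive_ord//; last exact: bigsetU_measurable.
rewrite -sumEFin; apply: eq_bigr => i _.
have := @lebesgue_measure_itv R `]l i, r i[ => /= ->.
rewrite lte_fin; case: ltP => // rl.
by rewrite (le_anti (_ : r i <= l i <= r i)) ?subrr// rl lr.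
Qed.

Lemma trivIset_itv_sum_le (n : nat) (l r : 'I_n -> R) (U : set R) (e : R) :
  (forall i, l i <= r i) ->
  trivIset [set: 'I_n] (fun i => `]l i, r i[%classic) ->
  (forall i, `]l i, r i[ `<=` U) -> measurable U -> (mu U < e%:E)%E ->
  \sum_(i < n) (r i - l i) < e.
Proof.
move=> lr tI lrU mU Ue.
rewrite -lte_fin -lebesgue_measure_bigsetU_itv//; apply: le_lt_trans Ue.
apply: le_measure; rewrite ?inE//; first exact: bigsetU_measurable.
apply: (big_ind (fun A => A `<=` U)) => // A B AU BU t [];
  [exact: AU|exact: BU].
Qed.

(** If [h] has zero derivative outside of an open set [U], then the total change
    of [h] is carried, up to an arbitrarily small slope [e], by finitely many
    disjoint intervals inside [U]. The proof propagates the statement from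
    [a, a] to [a, b] by real induction: near a point of [U] one adds an interval
    to the family, near any other point the slope [e] suffices. *)
Lemma variation_in_open (a b : R) (h : R -> R) (U : set R) (e : R) :
  a <= b -> 0 < e -> open U ->
  (forall t, a <= t <= b -> ~ U t -> is_derive t 1 h 0) ->
  exists n (l r : 'I_n -> R),
    [/\ forall i, [/\ a <= l i, l i <= r i & r i <= b],
        trivIset [set: 'I_n] (fun i => `]l i, r i[%classic),
        forall i, `]l i, r i[ `<=` U &
        `|h b - h a| <= e * (b - a) + \sum_(i < n) `|h (r i) - h (l i)|].
Proof.
move=> ab e0 oU h0.
pose P t := exists n (l r : 'I_n -> R),
    [/\ forall i, [/\ a <= l i, l i <= r i & r i <= t],
        trivIset [set: 'I_n] (fun i => `]l i, r i[%classic),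
        forall i, `]l i, r i[ `<=` U &
        `|h t - h a| <= e * (t - a) + \sum_(i < n) `|h (r i) - h (l i)|].
apply: (@real_induction _ a b P) => //.
  exists 0%N, (fun=> a), (fun=> a); split; [by case|by case|by case|].
  by rewrite big_ord0 !subrr normr0 mulr0 addr0.
move=> c cab; have [Uc|nUc] := pselect (U c).
  have /nbhs_ballP[rho /= rho0 cU] : nbhs c U by exact: open_nbhs_nbhs.
  exists rho => // s t /andP[sa sc] /andP[ct tb] cs tc.
  move=> [n [l [r [lr tI lrU hs]]]].
  (* The interval from [s] to [t] is appended as the last of the family. *)
  pose l' (i : 'I_n.+1) := if unlift ord_max i is Some j then l j else s.
  pose r' (i : 'I_n.+1) := if unlift ord_max i is Some j then r j else t.
  exists n.+1, l', r'; split.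
  - move=> i; rewrite /l' /r'.
    case: unliftP => [j _|_]; last by split=> //; lra.
    by have [? ? ?] := lr j; split=> //; lra.
  - move=> i j _ _ [x []]; rewrite /l' /r'.
    case: unliftP => [i' ->|->]; case: unliftP => [j' ->|->] //=.
    + by move=> xi xj; rewrite (tI i' j')//; exists x.
    + rewrite !in_itv/= => /andP[_ x1] /andP[x2 _].
      by have [_ _ /(lt_le_trans x1)/lt_trans/(_ x2)] := lr i'; rewrite ltxx.
    + rewrite !in_itv/= => /andP[x2 _] /andP[_ x1].
      by have [_ _ /(lt_le_trans x1)/lt_trans/(_ x2)] := lr j'; rewrite ltxx.
  - move=> i; rewrite /l' /r'; case: unliftP => [j _|_]; first exact: lrU.
    move=> x /=; rewrite in_itv/= => /andP[sx xt]; apply: cU.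
    by rewrite /ball/= ltr_norml; lra.
  - rewrite big_ord_recr/= /l' /r' unlift_none.
    under eq_bigr => i _.
      rewrite (_ : widen_ord _ i = lift ord_max i); last first.
        by apply: val_inj; rewrite /= /bump leqNgt ltn_ord.
      rewrite liftK; over.
    rewrite (_ : h t - h a = (h s - h a) + (h t - h s)); last by ring.
    rewrite (le_trans (ler_normD _ _))// addrA lerD2r (le_trans hs)// lerD2r.
    by rewrite ler_wpM2l ?(ltW e0)//; lra.
have [dc dh0] := h0 c cab nUc.
have hd : (fun k : R => k^-1 *: (h (k *: 1 + c) - h c)) @ 0^' --> 'D_1 h c.
  exact: dc.
move: hd; rewrite dh0 => /cvgrPdist_le /(_ e e0) /nbhs_ballP[rho /= rho0 hrho].
have hc t : `|t - c| < rho -> `|h t - h c| <= e * `|t - c|.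
  have [->|tc tcr] := eqVneq t c; first by rewrite !subrr normr0 mulr0.
  have := hrho (t - c); rewrite /ball/= sub0r normrN => /(_ tcr).
  rewrite subr_eq0 => /(_ tc).
  rewrite sub0r normrN /= scaler1 subrK normrZ normfV.
  by rewrite mulrC ler_pdivrMr// normr_gt0 subr_eq0.
exists rho => // s t /andP[sa sc] /andP[ct tb] cs tc.
move=> [n [l [r [lr tI lrU hs]]]].
exists n, l, r; split=> //.
  by move=> i; have [? ? ?] := lr i; split=> //; lra.
have := hc s; have := hc t.
rewrite (ger0_norm (_ : 0 <= t - c)) ?subr_ge0//.
rewrite (distrC s) (ger0_norm (_ : 0 <= c - s)) ?subr_ge0//.
move=> /(_ ltac:(lra)) ht /(_ ltac:(lra)) hs'.
rewrite (_ : h t - h a = (h t - h c) - (h s - h c) + (h s - h a)); last by ring.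
have := ler_normD ((h t - h c) - (h s - h c)) (h s - h a).
have := ler_normB (h t - h c) (h s - h c).
lra.
Qed.

(** The exceptional null set is covered by an open set [U] so small that, by
    absolute continuity, the variation of [h] over disjoint intervals inside [U]
    is negligible. *)
Lemma abs_cont_derive0 (a b : R) (h : R -> R) : a <= b -> abs_cont a b h ->
  {ae mu, forall t, a <= t <= b -> is_derive t 1 h 0} -> h b = h a.
Proof.
move=> ab ach [N [mN N0 hN]].
apply/eqP; rewrite -subr_eq0 -normr_le0.
apply/ler_addgt0Pl => e e0; rewrite addr0.
(* With slope [e'] over [a, b] and variation [e'] inside [U], the total is
   exactly [e]. *)
pose e' := e / (b - a + 1).
have ba : 0 < b - a + 1 by lra.
have e'0 : 0 < e' by exact: divr_gt0.
have [d d0 hd] := ach e' e'0.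
have Noo : (mu N < +oo)%E by rewrite N0.
have [U [oU NU Ud]] := lebesgue_regularity_outer mN Noo d0.
have mU : measurable U by exact: open_measurable.
have {}Ud : (mu U < d%:E)%E.
  rewrite (measureDI mu mU mN) [X in (_ + X)%E](_ : _ = 0%E) ?adde0//.
  by apply: (@subset_measure0 _ _ _ mu _ N) => //; exact: measurableI.
have [|n [l [r [lr tI lrU hlr]]]] := @variation_in_open a b h U e' ab e'0 oU.
  move=> t tab nUt; apply: contrapT => nd; apply/nUt/NU/hN => /=.
  by move/(_ tab).
have lr' i : l i <= r i by case: (lr i).
have := hd n l r lr tI (trivIset_itv_sum_le lr' tI lrU mU Ud).
have -> : e = e' * (b - a) + e' by rewrite /e'; field; lra.
lra.
Qed.

End constancy.

(** * The fundamental theorem of calculus *)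

Section primitive.
Context {R : realType}.
Notation mu := (@lebesgue_measure R).

Lemma abs_cont_integral (a b : R) (f : R -> R) :
  mu.-integrable setT (EFin \o f) ->
  abs_cont a b (fun t => \int[mu]_(x in `[a, t]) f x).
Proof.
move=> intf e e0; have [d [d0 fd]] := integral_normr_continuous intf e0.
exists d => // n l r lr tI sd.
have intfS (A : set R) : measurable A -> mu.-integrable A (EFin \o f).
  by move=> mA; apply: integrableS intf.
have intnf (A : set R) : measurable A ->
    mu.-integrable A (EFin \o (fun x => `|f x|)).
  by move=> mA; have := integrable_abse (intfS A mA).
pose F i : set R := `]l i, r i[%classic.
have mF i : measurable (F i) by exact: measurable_itv.
have mB : measurable (\big[setU/set0]_(i < n) F i) by exact: bigsetU_measurable.
have lr' i : l i <= r i by case: (lr i).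
apply: (@le_lt_trans _ _
    (\int[mu]_(x in \big[setU/set0]_(i < n) F i) `|f x|)); last first.
  apply: fd => //.
  by rewrite [ltLHS](lebesgue_measure_bigsetU_itv lr' tI) lte_fin.
apply: (@le_trans _ _ (\sum_(i < n) \int[mu]_(x in F i) `|f x|)).
  apply: ler_sum => i _; have [al le_lr rb] := lr i.
  rewrite Rintegral_itvB ?bnd_simp//; [|exact: intfS].
  by rewrite -Rintegral_itv_bndo_bndc ?le_normr_Rintegral//; exact: intfS.
rewrite /Rintegral ge0_integral_bigsetU//=.
- rewrite sum_fine// => i _.
  by apply: integrable_fin_num; [exact: mF|exact: intnf].
- by rewrite /index_enum -enumT enum_uniq.
- by move=> i j _ _; exact: tI.
- by have /integrableP[] := intnf _ mB.
Qed.

(** Almost everywhere differentiability of the indefinite integral is the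
    Lebesgue differentiation theorem. *)
Lemma ex_primitive (a b : R) (g : R -> R) :
  a <= b -> mu.-integrable `[a, b] (EFin \o g) ->
  exists G : R -> R, [/\ abs_cont a b G,
    {ae mu, forall t, a <= t <= b -> is_derive t 1 G (g t)},
    G a = 0 & G b = \int[mu]_(x in `[a, b]) g x].
Proof.
move=> ab intg; pose f := g \_ `[a, b].
have intf : mu.-integrable setT (EFin \o f).
  by move/integrable_mkcond : intg; rewrite restrict_EFin; apply.
exists (fun t => \int[mu]_(x in `[a, t]) f x); split.
- exact: abs_cont_integral.
- have intfS (A : set R) : measurable A -> mu.-integrable A (EFin \o f).
    by move=> mA; apply: integrableS intf.
  have locf : locally_integrable setT f by exact: integrable_locally intg.
  have := @FTC1 R f (BLeft a) (fun y => intfS _ (measurable_itv _)) locf.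
  (* The differentiation theorem says nothing at the left endpoint. *)
  have : {ae mu, forall t, t != a}.
    exists [set a]; split=> //; first exact: lebesgue_measure_set1.
    by move=> t /= /negP; rewrite negbK => /eqP.
  apply: filterS2; first exact: (ae_filter_ringOfSetsType mu).
  move=> t ta FTCt /andP[aT tb]; have [|dG G't] := FTCt.
    by rewrite /= lte_fin lt_neqAle eq_sym ta.
  apply: DeriveDef => //; rewrite -derive1E G't /f patchE mem_set//=.
  by rewrite in_itv/= aT.
- by rewrite set_itv1 Rintegral_set1.
- by rewrite -Rintegral_mkcondr setIid.
Qed.

(** The difference between [F] and a primitive of [f] has zero derivative almost
    everywhere. *)
Lemma abs_cont_FTC2 (a b : R) (F f : R -> R) : a <= b -> abs_cont a b F ->
  {ae mu, forall t, a <= t <= b -> is_derive t 1 F (f t)} ->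
  mu.-integrable `[a, b] (EFin \o f) ->
  \int[mu]_(x in `[a, b]) f x = F b - F a.
Proof.
move=> ab acF dF intf; have [G [acG dG Ga Gb]] := ex_primitive ab intf.
have := @abs_cont_derive0 R a b _ ab (abs_contB ab acF acG).
rewrite Ga -Gb => FG; apply/eqP.
rewrite eq_sym subr_eq addrC -subr_eq FG ?subr0//.
move: dF dG; apply: filterS2; first exact: (ae_filter_ringOfSetsType mu).
move=> t dF dG tab; rewrite -[X in is_derive _ _ _ X](subrr (f t)).
exact: is_deriveB (dF tab) (dG tab).
Qed.

End primitive.

(** * Square-integrable functions on the interval from 0 to 2 pi *)

Section square_integrable.
Context {R : realType}.
Notation mu := (@lebesgue_measure R).
Notation m := (@mu02pi R).
Implicit Types (f g : R -> R) (u v : L2 R).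

Lemma pi2_ge0 : 0 <= 2 * pi :> R.
Proof. by rewrite mulr_ge0 ?pi_ge0. Qed.

Lemma ae_mu02pi (P : R -> Prop) :
  {ae m, forall t, P t} <-> {ae mu, forall t, 0 <= t <= 2 * pi -> P t}.
Proof.
apply: iff_trans (ae_mrestr mu (measurable_itv `[0, 2 * pi]) P) _.
by split; apply: (@filterS _ _ (ae_filter_ringOfSetsType mu)) => t;
  rewrite /= in_itv.
Qed.

Lemma ae_mu02piS (P Q : R -> Prop) : (forall t, P t -> Q t) ->
  {ae m, forall t, P t} -> {ae m, forall t, Q t}.
Proof. by move=> PQ; apply: (@filterS _ _ (ae_filter_ringOfSetsType m)). Qed.

Lemma ae_mu02piS2 (P Q S : R -> Prop) : (forall t, P t -> Q t -> S t) ->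
  {ae m, forall t, P t} -> {ae m, forall t, Q t} -> {ae m, forall t, S t}.
Proof. by move=> PQS; apply: (@filterS2 _ _ (ae_filter_ringOfSetsType m)). Qed.

Lemma integrable_mu02pi f : measurable_fun setT f ->
  m.-integrable setT (EFin \o f) <-> mu.-integrable `[0, 2 * pi] (EFin \o f).
Proof. by move=> mf; apply: integrable_mrestr; exact/measurable_EFinP. Qed.

Lemma Rintegral_mu02pi f : measurable_fun setT f ->
  \int[m]_x f x = \int[mu]_(x in `[0, 2 * pi]) f x.
Proof.
by move=> mf; congr fine; apply: integral_mrestr; exact/measurable_EFinP.
Qed.

Lemma integral_poweR2 f :
  (\int[m]_x `|(EFin \o f) x| `^ 2 = \int[m]_x (f x ^+ 2)%:E)%E.
Proof.
by apply: eq_integral => x _ /=; rewrite powR_mulrn// real_normK// num_real.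
Qed.

Lemma Lfun2P f : measurable_fun setT f ->
  m.-integrable setT (EFin \o (fun x => f x ^+ 2)) -> f \in Lfun m 2%:E.
Proof.
move=> mf /integrableP[_ foo]; rewrite inE; apply/andP; split; rewrite inE//=.
rewrite /finite_norm unlock poweR_lty// integral_poweR2; apply: le_lt_trans foo.
rewrite le_eqVlt; apply/orP; left; apply/eqP/eq_integral => x _ /=.
by rewrite ger0_norm// sqr_ge0.
Qed.

Lemma Lfun_measurable f : f \in Lfun m 2%:E -> measurable_fun setT f.
Proof. by rewrite inE => /andP[]; rewrite inE. Qed.

Lemma Lfun2D f g : f \in Lfun m 2%:E -> g \in Lfun m 2%:E ->
  (fun t => f t + g t) \in Lfun m 2%:E.
Proof. by move=> fL gL; have [_] := Lfun_addr_closed m (lee1n 2); exact. Qed.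

Lemma Lfun2B f g : f \in Lfun m 2%:E -> g \in Lfun m 2%:E ->
  (fun t => f t - g t) \in Lfun m 2%:E.
Proof.
by move=> fL gL; apply: Lfun2D => //; exact: (@Lfun_oppr_closed _ _ _ m _ g gL).
Qed.

Lemma L2_Lfun u : (u : R -> R) \in Lfun m 2%:E.
Proof.
rewrite inE; apply/andP; split; rewrite inE/=.
  by apply: (@measurable_funPT _ _ _ _ (repr (LebesgueSpace.sort u))).
exact: Lebesgue_finite.
Qed.

Lemma L2norm_sqr f : f \in Lfun m 2%:E ->
  L2norm f ^+ 2 = \int[m]_x (f x ^+ 2).
Proof.
rewrite inE => /andP[_]; rewrite inE/= /finite_norm => foo.
have fN : ('N[m]_2%:E[EFin \o f])%E \is a fin_num.
  by rewrite ge0_fin_numE// Lnorm_ge0.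
rewrite /L2norm /Rintegral.
rewrite (_ : (\int[m]_x (f x ^+ 2)%:E = 'N[m]_2%:E[EFin \o f] `^ 2)%E).
  by rewrite -(fineK fN) poweR_EFin/= powR_mulrn// fine_ge0// Lnorm_ge0.
by rewrite powR_Lnorm// integral_poweR2.
Qed.

(** Elements of [L2 R] are classes: functions that agree almost everywhere
    define the same element. *)
Lemma L2_eq u v : {ae m, forall t, u t = v t} -> u = v.
Proof.
case: u v => [u [[Fu]]] [v [[Fv]]] /= uv.
have E : u = v.
  apply/eqP; rewrite -[u]reprK -[v]reprK; apply/ae_eqP.
  by apply: filterS uv => t ->.
case: _ / E in Fv uv *.
congr LebesgueSpace.Pack; congr LebesgueSpace.Class.
by congr isFinLebesgue.Axioms_; exact: bool_irrelevance.
Qed.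

(** Every square-integrable function is a representative of an element of
    [L2 R]. *)
Lemma ex_L2 f : f \in Lfun m 2%:E -> exists u, {ae m, forall t, u t = f t}.
Proof.
move=> fL.
pose F : {mfun measurableTypeR R >-> measurableTypeR R} :=
  HB.pack f (isMeasurableFun.Build _ _ (measurableTypeR R) (measurableTypeR R)
    f (Lfun_measurable fL)).
pose q : {mfun_ m, measurableTypeR R >-> measurableTypeR R} := \pi_(_)%qT F.
have qf : {ae m, forall t, q t = f t}.
  have /asboolP : ae_eq_op m (repr q) F by rewrite -eqmodE reprK.
  by apply: filterS => t /(_ Logic.I).
have qfin : finite_norm m 2%:E q.
  move: (fL); rewrite inE => /andP[_]; rewrite inE/=; apply: le_lt_trans.
  rewrite le_eqVlt; apply/orP; left; apply/eqP; rewrite unlock.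
  congr (_ `^ _)%E.
  rewrite !integral_poweR2; apply: ae_eq_integral => //.
  - have mq : measurable_fun [set: R] (q : R -> R).
      by apply: (@measurable_funPT _ _ _ _ (repr q)).
    by apply/measurable_EFinP; apply: measurable_funX.
  - by apply/measurable_EFinP; apply: measurable_funX; exact: Lfun_measurable.
  - by apply: filterS qf => t /= ->.
pose v : L2 R := HB.pack q (isFinLebesgue.Build _ _ _ _ _ (lee1n 2) q qfin).
by exists v.
Qed.

End square_integrable.

Section continuous_Lfun.
Context {R : realType}.
Notation mu := (@lebesgue_measure R).
Notation m := (@mu02pi R).
Implicit Types (f g : R -> R) (u v : L2 R).

Lemma within_continuous_Lfun f : {within `[0, 2 * pi], continuous f} ->
  f \_ `[0, 2 * pi] \in Lfun m 2%:E.
Proof.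
move=> cf.
have mf : measurable_fun setT (f \_ `[0, 2 * pi]).
  apply/(measurable_restrictT _ _).1 => //.
  by apply: subspace_continuous_measurable_fun.
apply: Lfun2P => //; apply/integrable_mu02pi; first exact: measurable_funX.
have cf2 : {within `[0, 2 * pi], continuous (fun t => f t ^+ 2)}.
  move=> t; apply: (@continuous_comp (subspace `[0, 2 * pi]) R R
    f (fun x : R => x ^+ 2)); [exact: cf|exact: exprn_continuous].
have : mu.-integrable `[0, 2 * pi] (EFin \o (fun t => f t ^+ 2)).
  by apply: continuous_compact_integrable; first exact: segment_compact.
apply: eq_integrable => // t tD /=; by rewrite patchE tD.
Qed.

Lemma continuous_Lfun f : continuous f -> f \in Lfun m 2%:E.
Proof.
move=> cf; have mf : measurable_fun setT f by exact: continuous_measurable_fun.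
apply: Lfun2P => //; apply/integrable_mu02pi; first exact: measurable_funX.
have cf2 : continuous (fun t => f t ^+ 2).
  move=> t; apply: (@continuous_comp _ R R f (fun x : R => x ^+ 2));
    [exact: cf|exact: exprn_continuous].
apply: continuous_compact_integrable; first exact: segment_compact.
exact: continuous_subspaceT.
Qed.

Lemma continuous_mul_Lfun f g : continuous f -> g \in Lfun m 2%:E ->
  (fun t => f t * g t) \in Lfun m 2%:E.
Proof.
move=> cf gL; have mg := Lfun_measurable gL.
have mf : measurable_fun setT f by exact: continuous_measurable_fun.
apply: Lfun2P; first exact: measurable_funM.
apply/integrable_mu02pi.
  by apply: measurable_funX; exact: measurable_funM.
have /integrable_mu02pi ig := Lfun2_integrable_sqr gL.
have mf2 : measurable_fun `[0, 2 * pi] (fun t => f t ^+ 2).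
  by apply: measurable_funTS; exact: measurable_funX.
have bf2 : [bounded f t ^+ 2 | t in `[0, 2 * pi]].
  have cf2 : continuous (fun t => f t ^+ 2).
    move=> t; apply: (@continuous_comp _ R R f (fun x : R => x ^+ 2));
      [exact: cf|exact: exprn_continuous].
  have [c _ fc] := EVT_max pi2_ge0 (continuous_subspaceT cf2).
  exists (f c ^+ 2); split; first exact: num_real.
  move=> M /ltW cM t tD.
  by rewrite /= ger0_norm ?sqr_ge0// (le_trans _ cM)// fc.
have mg2 : measurable_fun setT (fun t => g t ^+ 2) by exact: measurable_funX.
have := @integrableMl _ (measurableTypeR R) R mu _ (measurable_itv _) _ _
  (ig mg2) mf2 bf2.
by apply: eq_integrable => // t _ /=; rewrite exprMn mulrC.
Qed.

Lemma Lfun_integrable1 f : f \in Lfun m 2%:E -> m.-integrable setT (EFin \o f).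
Proof.
move=> fL; apply/Lfun1_integrable.
have cL : cst 1 \in Lfun m 2%:E.
  by apply: continuous_Lfun; exact: cst_continuous.
rewrite (_ : f = f \* cst 1); first exact: Lfun2_mul_Lfun1 fL cL.
by apply/funext => t /=; rewrite mulr1.
Qed.

(** Outside of the interval an absolutely continuous function need not be
    measurable, so its class is that of its restriction. *)
Lemma abs_cont_ex_L2 f : abs_cont 0 (2 * pi) f ->
  exists u, {ae m, forall t, f t = u t}.
Proof.
move=> /(abs_cont_continuous pi2_ge0)/within_continuous_Lfun/ex_L2[u uf].
exists u; move: uf; rewrite !ae_mu02pi.
apply: (@filterS _ _ (ae_filter_ringOfSetsType mu)) => t + tD => /(_ tD) ->.
by rewrite patchE mem_set//= in_itv.
Qed.

Lemma ae_derivative_integral f g : abs_cont 0 (2 * pi) f ->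
  has_ae_derivative f g -> g \in Lfun m 2%:E ->
  \int[m]_x g x = f (2 * pi) - f 0.
Proof.
move=> acf dfg gL; have mg := Lfun_measurable gL.
rewrite Rintegral_mu02pi//; apply: abs_cont_FTC2 => //.
- exact: pi2_ge0.
- exact/ae_mu02pi.
- exact/integrable_mu02pi/Lfun_integrable1.
Qed.

Lemma ex_ae_primitive f : f \in Lfun m 2%:E ->
  exists F, [/\ abs_cont 0 (2 * pi) F, has_ae_derivative F f & F 0 = 0].
Proof.
move=> fL; have mf := Lfun_measurable fL.
have /(integrable_mu02pi mf) intf := Lfun_integrable1 fL.
have [F [acF dF F0 _]] := ex_primitive pi2_ge0 intf.
by exists F; split=> //; exact/ae_mu02pi.
Qed.

End continuous_Lfun.

(** * Derivatives of explicit functions *)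

(** The rules below restate the differentiation rules for functions written as
    abstractions, the form in which the states of the oscillator occur. *)
Section derivatives.
Context {R : realType}.
Implicit Types (f g : R -> R) (t c : R).

Lemma is_derive_cst_fun c t : is_derive t 1 (fun=> c) 0.
Proof. exact: is_derive_cst. Qed.

Lemma is_derive_id_fun t : is_derive t 1 (fun x : R => x) 1.
Proof. exact: is_derive_id. Qed.

Lemma is_deriveD_fun f g t (a b : R) : is_derive t 1 f a -> is_derive t 1 g b ->
  is_derive t 1 (fun x => f x + g x) (a + b).
Proof. by move=> df dg; exact: is_deriveD. Qed.

Lemma is_deriveB_fun f g t (a b : R) : is_derive t 1 f a -> is_derive t 1 g b ->
  is_derive t 1 (fun x => f x - g x) (a - b).
Proof. by move=> df dg; exact: is_deriveB. Qed.

Lemma is_deriveM_fun f g t (a b : R) : is_derive t 1 f a -> is_derive t 1 g b ->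
  is_derive t 1 (fun x => f x * g x) (f t * b + a * g t).
Proof.
move=> df dg; apply: is_derive_eq (is_deriveM df dg) _.
by rewrite /GRing.scale/= (mulrC a).
Qed.

Lemma is_derive_expRM c t :
  is_derive t 1 (fun x => expR (c * x)) (c * expR (c * t)).
Proof.
have dc : is_derive t 1 (fun x => c * x) c.
  apply: is_derive_eq
    (is_deriveM_fun (is_derive_cst_fun c t) (is_derive_id_fun t)) _.
  by ring.
have := is_derive1_comp (is_derive_expR (c * t)) dc.
by move=> h; apply: is_derive_eq h _; rewrite mulrC.
Qed.

Lemma is_derive_continuous f f' :
  (forall t, is_derive t 1 f (f' t)) -> continuous f.
Proof.
move=> df t; apply/differentiable_continuous/derivable1_diffP.
by have [] := df t.
Qed.

End derivatives.

(** Computes the derivative of a polynomial expression in exponentials and in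
    functions whose derivatives are hypotheses. *)
Ltac is_derive_fun := repeat first
  [ eassumption | apply: is_derive_expRM
  | apply: is_derive_cst_fun | apply: is_derive_id_fun
  | apply: is_deriveB_fun | apply: is_deriveD_fun | apply: is_deriveM_fun ].

Section exponential.
Context {R : realType}.
Implicit Types c t : R.

Lemma continuous_expRM c : continuous (fun t => expR (c * t)).
Proof. by apply: is_derive_continuous => t; exact: is_derive_expRM. Qed.

Lemma abs_cont_expRM (a b c : R) : a <= b ->
  abs_cont a b (fun t => expR (c * t)).
Proof.
move=> ab; apply: (derive_abs_cont ab (fun t => is_derive_expRM c t)).
apply: (@is_derive_continuous _ _ (fun t => c * (c * expR (c * t)))) => t.
eapply is_derive_eq; first by is_derive_fun.
by rewrite /GRing.scale/=; ring.
Qed.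

End exponential.

(** * States of the oscillator *)

Section oscillator.
Context {R : realType}.
Notation m := (@mu02pi R).
Implicit Types (x : R -> R) (u v : L2 R).

Lemma expRMN (w t : R) : expR (- w * t) * expR (w * t) = 1.
Proof. by rewrite -expRD mulNr addNr expR0. Qed.

(** The two square-integrability clauses in the definition of [W12] follow from
    absolute continuity and from the equation. *)
Lemma oscillator_stateI (w : R) u (x1 x2 : R -> R) :
  abs_cont 0 (2 * pi) x1 -> abs_cont 0 (2 * pi) x2 -> has_ae_derivative x1 x2 ->
  has_ae_derivative x2 (fun t => - w ^+ 2 * x1 t - 2 * w * x2 t + u t) ->
  oscillator_state w u x1 x2.
Proof.
move=> ac1 ac2 d1 d2.
have [v1 x1v1] := abs_cont_ex_L2 ac1.
have [v2 x2v2] := abs_cont_ex_L2 ac2.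
split=> //; split=> //; [by exists v1|exists v2|by exists v2|].
  by apply: ae_mu02piS2 d1 x2v2 => t d1 <-.
have acf : abs_cont 0 (2 * pi) (fun t => - w ^+ 2 * x1 t - 2 * w * x2 t).
  by apply: abs_contB; [exact: pi2_ge0|apply: abs_contZ|apply: abs_contZ];
    rewrite ?pi2_ge0.
have [f0 fE] := abs_cont_ex_L2 acf.
have [f fuE] := ex_L2 (Lfun2D (L2_Lfun f0) (L2_Lfun u)).
have d2' : {ae m, forall t : R, is_derive t 1 x2 (f0 t + u t)}.
  by apply: ae_mu02piS2 d2 fE => t d2t <-.
by exists f; apply: ae_mu02piS2 d2' fuE => t d2t ->.
Qed.

(** The substitution z1 = e^(w t) x1, z2 = z1' turns the critically damped
    equation into z1' = z2, z2' = e^(w t) u, which is solved by integrating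
    twice. *)
Lemma ex_oscillator_state (w s v : R) u : exists x1 x2,
  [/\ oscillator_state w u x1 x2, x1 0 = s & x2 0 = v].
Proof.
have [F [acF dF F0]] := ex_ae_primitive
  (continuous_mul_Lfun (@continuous_expRM R w) (L2_Lfun u)).
pose z2 t := v + w * s + F t.
have acz2 : abs_cont 0 (2 * pi) z2.
  by apply: abs_contD => //; exact: abs_cont_cst.
have [H [acH dH H0]] :=
  ex_ae_primitive (within_continuous_Lfun (abs_cont_continuous pi2_ge0 acz2)).
pose z1 t := s + H t.
have acz1 : abs_cont 0 (2 * pi) z1.
  by apply: abs_contD => //; exact: abs_cont_cst.
have {}dH : has_ae_derivative H z2.
  move: dH => /ae_mu02pi dH; apply/ae_mu02pi.
  move: dH; apply: (@filterS _ _ (ae_filter_ringOfSetsType _)) => t dH tD.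
  by move: (dH tD); rewrite patchE mem_set//= in_itv.
have acexp : abs_cont 0 (2 * pi) (fun t => expR (- w * t)).
  exact: abs_cont_expRM pi2_ge0.
exists (fun t => expR (- w * t) * z1 t).
exists (fun t => expR (- w * t) * (z2 t - w * z1 t)).
split; last 2 first.
- by rewrite /z1 H0 mulr0 expR0; ring.
- by rewrite /z1 /z2 H0 F0 mulr0 expR0; ring.
apply: oscillator_stateI.
- exact: abs_contM pi2_ge0 acexp acz1.
- apply: abs_contM pi2_ge0 acexp _.
  apply: abs_contB => //; first exact: pi2_ge0.
  exact: abs_contZ pi2_ge0 acz1.
- apply: ae_mu02piS dH => t dH; rewrite /z1.
  eapply is_derive_eq; first by is_derive_fun.
  by rewrite /GRing.scale/=; ring.
- apply: ae_mu02piS2 dF dH => t dF dH; rewrite /z2 /z1.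
  eapply is_derive_eq; first by is_derive_fun.
  rewrite /GRing.scale/= /z2.
  have := expRMN w t; set e := expR _; set e' := expR _ => ee'.
  by rewrite -[X in _ = _ + X]mul1r -[X in _ = _ + X * _]ee'; ring.
Qed.

End oscillator.

(** * Orthogonality of admissible variations *)

Section orthogonality.
Context {R : realType}.
Notation m := (@mu02pi R).

(** A difference of two controls steering the oscillator between the same states
    is orthogonal to e^(w t) and t e^(w t). *)
Lemma oscillator_state_orthogonal (w al be : R) (u v : L2 R)
    (x1 x2 y1 y2 : R -> R) :
  oscillator_state w u x1 x2 -> oscillator_state w v y1 y2 ->
  x1 0 = y1 0 -> x2 0 = y2 0 ->
  x1 (2 * pi) = y1 (2 * pi) -> x2 (2 * pi) = y2 (2 * pi) ->
  \int[m]_t (expR (w * t) * (al + be * t) * (u t - v t)) = 0.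
Proof.
move=> [[acx1 _ _] [acx2 _ _] dx1 dx2] [[acy1 _ _] [acy2 _ _] dy1 dy2].
move=> E10 E20 E1 E2.
pose e1 t := x1 t - y1 t; pose e2 t := x2 t - y2 t.
have T0 : 0 <= 2 * pi :> R := pi2_ge0.
have ace1 : abs_cont 0 (2 * pi) e1 by exact: abs_contB.
have ace2 : abs_cont 0 (2 * pi) e2 by exact: abs_contB.
pose k t := expR (w * t) * (al + be * t).
have acexp : abs_cont 0 (2 * pi) (fun t => expR (w * t)).
  exact: abs_cont_expRM.
have dk (t : R) : is_derive t 1 k (w * k t + be * expR (w * t)).
  eapply is_derive_eq; first by rewrite /k; is_derive_fun.
  by rewrite /k /GRing.scale/=; ring.
have ck : continuous k by exact: is_derive_continuous dk.
have ack : abs_cont 0 (2 * pi) k.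
  apply: abs_contM => //; apply: abs_contD; first exact: abs_cont_cst.
  by apply: abs_contZ => //; exact: abs_cont_id.
(* The derivative of [G] is the integrand, and [G] vanishes with the states
   [e1], [e2]. It is the integration by parts of [k] times the difference of
   the controls, where e^(w t) (e2 + w e1) is a primitive of e^(w t) times that
   difference and e^(w t) e1 is a primitive of this primitive. *)
pose G t := k t * (e2 t + w * e1 t) - be * (expR (w * t) * e1 t).
have acG : abs_cont 0 (2 * pi) G.
  apply: abs_contB => //.
    by apply: abs_contM => //; apply: abs_contD => //; exact: abs_contZ.
  by apply: abs_contZ => //; exact: abs_contM.
have dG : has_ae_derivative G (fun t => k t * (u t - v t)).
  have d1 : {ae m, forall t : R, is_derive t 1 e1 (e2 t)}.
    by apply: ae_mu02piS2 dx1 dy1 => t; exact: is_deriveB_fun.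
  have d2 : {ae m, forall t : R, is_derive t 1 e2
      (- w ^+ 2 * e1 t - 2 * w * e2 t + (u t - v t))}.
    apply: ae_mu02piS2 dx2 dy2 => t dx dy.
    apply: is_derive_eq (is_deriveB_fun dx dy) _.
    by rewrite /e1 /e2; ring.
  apply: ae_mu02piS2 d1 d2 => t d1 d2; rewrite /G.
  have dkt := dk t.
  eapply is_derive_eq; first by is_derive_fun.
  by rewrite /k /GRing.scale/=; ring.
rewrite (ae_derivative_integral acG dG).
  by rewrite /G /e1 /e2 E10 E20 E1 E2; ring.
exact: continuous_mul_Lfun ck (Lfun2B (L2_Lfun u) (L2_Lfun v)).
Qed.

End orthogonality.

(** * Projections in L2 *)

Section projection.
Context {R : realType}.
Notation m := (@mu02pi R).

Lemma Lfun2_mul_integrable (f g : R -> R) :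
  f \in Lfun m 2%:E -> g \in Lfun m 2%:E ->
  m.-integrable setT (EFin \o (fun t => f t * g t)).
Proof.
by move=> fL gL; apply/Lfun1_integrable; exact: Lfun2_mul_Lfun1 fL gL.
Qed.

Lemma L2norm_pythagoras (f g : R -> R) :
  f \in Lfun m 2%:E -> g \in Lfun m 2%:E ->
  \int[m]_t (f t * g t) = 0 ->
  L2norm (fun t => f t + g t) ^+ 2 = L2norm f ^+ 2 + L2norm g ^+ 2.
Proof.
move=> fL gL fg0; rewrite !L2norm_sqr//; last exact: Lfun2D.
have if2 := Lfun2_integrable_sqr fL; have ig2 := Lfun2_integrable_sqr gL.
have ifg := Lfun2_mul_integrable fL gL.
transitivity (\int[m]_t (f t ^+ 2 + (2 * (f t * g t) + g t ^+ 2))).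
  by congr fine; apply: eq_integral => t _; congr EFin; ring.
have i2fg : m.-integrable setT (EFin \o (fun t => 2 * (f t * g t))).
  by have := integrableZl measurableT 2 ifg; apply: eq_integrable.
rewrite RintegralD//; last first.
  exact: (integrableD _ i2fg ig2).
by rewrite RintegralD// RintegralZl// fg0 mulr0 add0r.
Qed.

Lemma L2norm_eq0 (u v : L2 R) : L2norm (u \- v) = 0 -> u = v.
Proof.
move=> uv0; apply: L2_eq.
have uvL : u \- v \in Lfun m 2%:E by exact: Lfun2B (L2_Lfun u) (L2_Lfun v).
have muv : measurable_fun setT (EFin \o (u \- v)).
  by apply/measurable_EFinP; exact: Lfun_measurable uvL.
have N0 : ('N[m]_2%:E[EFin \o (u \- v)%R] = 0)%E.
  move: uvL; rewrite inE => /andP[_]; rewrite inE/= /finite_norm => uvoo.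
  by rewrite -[LHS]fineK ?ge0_fin_numE ?Lnorm_ge0// [fine _]uv0.
have : (0 < 2%:E :> \bar R)%E by rewrite lte_fin.
move=> /(Lnorm_eq0_eq0 muv)/(_ N0); apply: ae_mu02piS => t /(_ Logic.I) [] /eqP.
by rewrite subr_eq0 => /eqP.
Qed.

(** Sufficient condition for [p] to be the projection, by Pythagoras. *)
Lemma is_projection_orthogonal (A : set (L2 R)) (u p : L2 R) : A p ->
  (forall v, A v -> \int[m]_t ((v t - p t) * (p t - u t)) = 0) ->
  is_projection A u p.
Proof.
move=> Ap Aorth.
have E v : A v ->
    L2norm (v \- u) ^+ 2 = L2norm (v \- p) ^+ 2 + L2norm (p \- u) ^+ 2.
  move=> Av; rewrite -L2norm_pythagoras//; last 3 first.
  - exact: Lfun2B (L2_Lfun v) (L2_Lfun p).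
  - exact: Lfun2B (L2_Lfun p) (L2_Lfun u).
  - exact: Aorth.
  by congr (L2norm _ ^+ 2); apply/funext => t /=; rewrite subrKA.
split=> [|q [Aq qmin]].
  split=> // v Av; rewrite ler_wpM2l ?invr_ge0// (E v Av).
  by rewrite lerDr sqr_ge0.
apply: L2norm_eq0; apply/eqP; rewrite -sqrf_eq0 eq_le sqr_ge0 andbT.
have := qmin p Ap; rewrite ler_pM2l ?invr_gt0// (E q Aq).
by rewrite gerDr.
Qed.

End projection.

(** * The determinant in the formula *)

Section correction.
Context {R : realType}.

Lemma sinh_gt (a : R) : 0 < a -> a < sinh a.
Proof.
move=> a0; pose h (t : R) := expR (1 * t) - expR (-1 * t) - 2 * t.
have dh (t : R) : is_derive t 1 h (expR (1 * t) + expR (-1 * t) - 2).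
  eapply is_derive_eq; first by rewrite /h; is_derive_fun.
  by rewrite /GRing.scale/=; ring.
(* The mean value theorem for [h], whose derivative at [c] is
   (e^c - 1)^2 / e^c. *)
have [c ca] := @MVT R h _ 0 a a0 (fun t _ => dh t)
  (continuous_subspaceT (is_derive_continuous dh)).
move: ca; rewrite in_itv/= => /andP[c0 _].
rewrite {1}/h {1}/h !mulr0 expR0 !mul1r mulN1r !subrr subr0 subr0 => hc.
suff : 0 < (expR c + expR (-1 * c) - 2) * a by rewrite -hc /sinh; lra.
rewrite mulr_gt0// mulN1r expRN.
have E1 : 1 < expR c by rewrite -expR0 ltr_expR.
have E0 : 0 < expR c by exact: expR_gt0.
have -> : expR c + (expR c)^-1 - 2 = (expR c - 1) ^+ 2 / expR c.
  by field; rewrite gt_eqF.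
by rewrite divr_gt0// exprn_gt0// subr_gt0.
Qed.

(** The denominator of the formula. It is the determinant of the Gram matrix of
    e^(w (t - pi)) and t e^(w (t - pi)) in L2. *)
Definition gram_det (w : R) := y11 w * y22 w - y12 w * y21 w.

Lemma expR_2piN (w : R) : expR (- 2 * pi * w) = (expR (2 * pi * w))^-1.
Proof. by rewrite -expRN; congr expR; ring. Qed.

Lemma expR_4pi (w : R) : expR (4 * pi * w) = expR (2 * pi * w) ^+ 2.
Proof. by rewrite expr2 -expRD; congr expR; ring. Qed.

Lemma gram_detE (w : R) : w != 0 ->
  gram_det w = (sinh (2 * pi * w) ^+ 2 - (2 * pi * w) ^+ 2) / (4 * w ^+ 4).
Proof.
move=> w0; rewrite /gram_det /y11 /y12 /y21 /y22 /sinh expR_2piN expR_4pi.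
rewrite (expRN (2 * pi * w)).
have : expR (2 * pi * w) != 0 by rewrite gt_eqF// expR_gt0.
move: (expR _) => E E0; field.
by rewrite w0.
Qed.

Lemma gram_det_gt0 (w : R) : 0 < w -> 0 < gram_det w.
Proof.
move=> w0; rewrite gram_detE ?gt_eqF//.
have a0 : 0 < 2 * pi * w by rewrite !mulr_gt0// pi_gt0.
rewrite divr_gt0//; last by rewrite mulr_gt0// exprn_gt0.
by rewrite subr_gt0 ltrXn2r// ?ltW// ?(lt_trans a0)// sinh_gt.
Qed.

End correction.

(** * Response to the controls e^(w t) (al + be t) *)

Section forced_response.
Context {R : realType}.
Implicit Types w al be t : R.

(** The functions [response1] and [response2] are the components of the state
    starting from rest under the control e^(w t) (al + be t). In the variables
    z1 = e^(w t) x1, z2 = z1' they are [response_position], the primitive of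
    [response_velocity] that vanishes at 0, and [response_velocity], the
    primitive of e^(2 w t) (al + be t) that vanishes at 0. *)
Definition response_velocity w al be t : R :=
  al * ((expR (w * t) * expR (w * t) - 1) * (2 * w)^-1)
  + be * (t * (expR (w * t) * expR (w * t)) * (2 * w)^-1
          - (expR (w * t) * expR (w * t) - 1) * (4 * w ^+ 2)^-1).

Definition response_position w al be t : R :=
  al * ((expR (w * t) * expR (w * t) - 1) * (4 * w ^+ 2)^-1 - t * (2 * w)^-1)
  + be * (t * (expR (w * t) * expR (w * t) + 1) * (4 * w ^+ 2)^-1
          - (expR (w * t) * expR (w * t) - 1) * (4 * w ^+ 3)^-1).

Definition response1 w al be t : R :=
  expR (- w * t) * response_position w al be t.

Definition response2 w al be t : R :=
  expR (- w * t)
  * (response_velocity w al be t - w * response_position w al be t).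

Lemma is_derive_response1 w al be t : w != 0 ->
  is_derive t 1 (response1 w al be) (response2 w al be t).
Proof.
move=> w0; rewrite /response1 /response2 /response_velocity /response_position.
eapply is_derive_eq; first by is_derive_fun.
by rewrite /GRing.scale/=; field; rewrite w0.
Qed.

Lemma is_derive_response2 w al be t : w != 0 ->
  is_derive t 1 (response2 w al be)
    (- w ^+ 2 * response1 w al be t - 2 * w * response2 w al be t
     + expR (w * t) * (al + be * t)).
Proof.
move=> w0; rewrite /response1 /response2 /response_velocity /response_position.
eapply is_derive_eq; first by is_derive_fun.
rewrite /GRing.scale/=.
have := expRMN w t; set e := expR (- w * t); set e' := expR _ => ee'.
rewrite -[X in _ = _ + X]mul1r -[X in _ = _ + X * _]ee'.
by field; rewrite w0.
Qed.

Lemma response1_0 w al be : response1 w al be 0 = 0.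
Proof. by rewrite /response1 /response_position !mulr0 expR0; ring. Qed.

Lemma response2_0 w al be : response2 w al be 0 = 0.
Proof.
by rewrite /response2 /response_velocity /response_position !mulr0 expR0; ring.
Qed.

Lemma abs_cont_response1 w al be : w != 0 ->
  abs_cont 0 (2 * pi) (response1 w al be).
Proof.
move=> w0; apply: (derive_abs_cont pi2_ge0
  (fun t => is_derive_response1 al be t w0)).
exact: is_derive_continuous (fun t => is_derive_response2 al be t w0).
Qed.

Lemma abs_cont_response2 w al be : w != 0 ->
  abs_cont 0 (2 * pi) (response2 w al be).
Proof.
move=> w0; apply: (derive_abs_cont pi2_ge0
  (fun t => is_derive_response2 al be t w0)).
pose d1 t := is_derive_response1 al be t w0.
pose d2 t := is_derive_response2 al be t w0.
eapply is_derive_continuous => t.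
have d1t := d1 t; have d2t := d2 t.
is_derive_fun.
Qed.

(** With the coefficients of the formula, the response at time 2 pi cancels the
    deviation of the final state; [e1] and [e2] are the components of that
    deviation multiplied by e^(2 pi w). *)
Lemma response_final w e1 e2 : 0 < w ->
  let E := expR (2 * pi * w) in
  let al := E^-1 / gram_det w * (- y12 w * e1 + y11 w * e2) in
  let be := E^-1 / gram_det w *
    (- (y22 w + y12 w * w) * e1 + (y21 w + y11 w * w) * e2) in
  response1 w al be (2 * pi) = - (E^-1 * e1) /\
  response2 w al be (2 * pi) = - (E^-1 * e2).
Proof.
move=> w0 E al be.
have D0 : gram_det w != 0 by rewrite gt_eqF// gram_det_gt0.
have wn0 : w != 0 by rewrite gt_eqF.
have E0 : E != 0 by rewrite gt_eqF// expR_gt0.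
have ET : expR (w * (2 * pi)) = E by congr expR; ring.
have ETN : expR (- w * (2 * pi)) = E^-1 by rewrite -expRN; congr expR; ring.
(* [P1], [Q1] and [P2], [Q2] are the coefficients of [al], [be] in the final
   [response_position] and [response_velocity]. *)
pose P1 := (E * E - 1) * (4 * w ^+ 2)^-1 - 2 * pi * (2 * w)^-1.
pose Q1 := 2 * pi * (E * E + 1) * (4 * w ^+ 2)^-1
  - (E * E - 1) * (4 * w ^+ 3)^-1.
pose P2 := (E * E - 1) * (2 * w)^-1.
pose Q2 := 2 * pi * (E * E) * (2 * w)^-1 - (E * E - 1) * (4 * w ^+ 2)^-1.
have pE : response_position w al be (2 * pi) = al * P1 + be * Q1.
  by rewrite /response_position ET.
have vE : response_velocity w al be (2 * pi) = al * P2 + be * Q2.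
  by rewrite /response_velocity ET.
have DE : gram_det w = y11 w * y22 w - y12 w * y21 w by [].
have yE : [/\ y12 w * P1 + (y22 w + y12 w * w) * Q1 = E * gram_det w,
  y11 w * P1 + (y21 w + y11 w * w) * Q1 = 0,
  y12 w * P2 + (y22 w + y12 w * w) * Q2 = w * (E * gram_det w) &
  y11 w * P2 + (y21 w + y11 w * w) * Q2 = - (E * gram_det w) ].
  rewrite DE /P1 /Q1 /P2 /Q2 /y11 /y12 /y21 /y22 /sinh expR_2piN expR_4pi.
  rewrite (expRN (2 * pi * w)) -/E.
  move: E E0 {ET ETN al be P1 Q1 P2 Q2 pE vE} => E E0.
  by split; field; rewrite wn0 E0.
have [Y1 Y2 Y3 Y4] := yE.
rewrite /response1 /response2 pE vE ETN; split.
- transitivity (E^-1 * (E^-1 / gram_det w *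
    (- e1 * (y12 w * P1 + (y22 w + y12 w * w) * Q1)
     + e2 * (y11 w * P1 + (y21 w + y11 w * w) * Q1)))).
    by rewrite /al /be; ring.
  by rewrite Y1 Y2; field; rewrite D0 E0.
- transitivity (E^-1 * (E^-1 / gram_det w *
    (- e1 * ((y12 w * P2 + (y22 w + y12 w * w) * Q2)
             - w * (y12 w * P1 + (y22 w + y12 w * w) * Q1))
     + e2 * ((y11 w * P2 + (y21 w + y11 w * w) * Q2)
             - w * (y11 w * P1 + (y21 w + y11 w * w) * Q1))))).
    by rewrite /al /be; ring.
  by rewrite Y1 Y2 Y3 Y4; field; rewrite D0 E0.
Qed.

End forced_response.

(** * The projection formula *)

Theorem corollary5 (R : realType) (omega0 s0 sf v0 vf : R) (u : L2 R) :
  0 < omega0 ->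
  (exists x1 x2 : R -> R,
     [/\ oscillator_state omega0 u x1 x2, x1 0 = s0 & x2 0 = v0]) /\
  (forall x1 x2 : R -> R,
     oscillator_state omega0 u x1 x2 -> x1 0 = s0 -> x2 0 = v0 ->
     let xh1 := expR (2 * pi * omega0) * x1 (2 * pi) in
     let xh2 := expR (2 * pi * omega0) * x2 (2 * pi) in
     exists p : L2 R,
       is_projection (admissible_controls omega0 s0 sf v0 vf) u p /\
       {ae mu02pi, forall t,
          p t = projection_formula omega0 sf vf xh1 xh2 u t}).
Proof.
move=> w0; split; first exact: ex_oscillator_state.
move=> x1 x2 xu x10 x20 xh1 xh2.
have wn0 : omega0 != 0 by rewrite gt_eqF.
set w := omega0 in w0 wn0 xh1 xh2 xu *.
pose E := expR (2 * pi * w).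
have E0 : E != 0 by rewrite gt_eqF// expR_gt0.
pose e1 := xh1 - sf / expR (- 2 * pi * w).
pose e2 := xh2 - vf / expR (- 2 * pi * w).
pose al := E^-1 / gram_det w * (- y12 w * e1 + y11 w * e2).
pose be := E^-1 / gram_det w *
  (- (y22 w + y12 w * w) * e1 + (y21 w + y11 w * w) * e2).
pose k t := expR (w * t) * (al + be * t).
have formulaE t : projection_formula w sf vf xh1 xh2 u t = u t + k t.
  rewrite /projection_formula -/e1 -/e2 -/(gram_det w) /k /al /be.
  have -> : expR (w * (t - 2 * pi)) = expR (w * t) * E^-1.
    by rewrite -expRN -expRD; congr expR; ring.
  by congr (_ + _); ring.
have ck : continuous k.
  apply: (@is_derive_continuous _ _
    (fun t => w * k t + be * expR (w * t))) => t.
  eapply is_derive_eq; first by rewrite /k; is_derive_fun.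
  by rewrite /k /GRing.scale/=; ring.
have [p pE] := ex_L2 (Lfun2D (L2_Lfun u) (continuous_Lfun ck)).
exists p; split; last by apply: ae_mu02piS pE => t ->; rewrite formulaE.
have [r1T r2T] := response_final e1 e2 w0.
rewrite -/E -/al -/be in r1T r2T.
have [[acx1 _ _] [acx2 _ _] dx1 dx2] := xu.
(* The state driven by [p] is that driven by [u] plus the response to [k]. *)
pose z1 t := x1 t + response1 w al be t.
pose z2 t := x2 t + response2 w al be t.
have zp : oscillator_state w p z1 z2.
  apply: oscillator_stateI.
  - by apply: abs_contD => //; exact: abs_cont_response1.
  - by apply: abs_contD => //; exact: abs_cont_response2.
  - apply: ae_mu02piS dx1 => t dx1.
    exact: is_deriveD_fun dx1 (is_derive_response1 _ _ _ wn0).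
  - apply: ae_mu02piS2 dx2 pE => t dx2 ->.
    apply: is_derive_eq
      (is_deriveD_fun dx2 (is_derive_response2 al be t wn0)) _.
    by rewrite /z1 /z2 /k; ring.
have z10 : z1 0 = s0 by rewrite /z1 response1_0 addr0.
have z20 : z2 0 = v0 by rewrite /z2 response2_0 addr0.
have z1T : z1 (2 * pi) = sf.
  by rewrite /z1 r1T /e1 /xh1 expR_2piN -/E; field.
have z2T : z2 (2 * pi) = vf.
  by rewrite /z2 r2T /e2 /xh2 expR_2piN -/E; field.
apply: is_projection_orthogonal; first by exists z1, z2.
move=> v [a1 [a2 [av a10 a1T a20 a2T]]].
have := @oscillator_state_orthogonal R w al be v p a1 a2 z1 z2 av zp.
rewrite a10 a20 a1T a2T z10 z20 z1T z2T => /(_ erefl erefl erefl erefl) <-.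
have vpL := Lfun2B (L2_Lfun v) (L2_Lfun p).
have puL := Lfun2B (L2_Lfun p) (L2_Lfun u).
congr fine; apply: ae_eq_integral => //.
- apply/measurable_EFinP; apply: measurable_funM; exact: Lfun_measurable.
- apply/measurable_EFinP; exact: Lfun_measurable (continuous_mul_Lfun ck vpL).
- apply: ae_mu02piS pE => t pt _; congr EFin.
  by rewrite [X in _ * (X - _)]pt /k; ring.
Qed.
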